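(* Let $\Delta=\langle F_1,\dots,F_q\rangle$ be a simplicial complex, let $I=(f_1,\dots,f_q)$ be its facet ideal, and let $J$ be the defining ideal of the Rees algebra $R[It]$. Then $$J=J_1S+\Big(\bigcup_{i=2}^{\infty}P_i\Big)S,$$ where $P_i=\{T_{\alpha,\beta}(I):\alpha,\beta\in\mathcal{I}_i\text{ and }\mathcal{C}_{\alpha,\beta}\text{ is a simplicial even walk}\}$.
   Context: Let $\Delta=\langle F_1,\dots,F_q\rangle$ be a simplicial complex with (distinct) facets $F_1,\dots,F_q$ on vertex set $V(\Delta)=\{x_1,\dots,x_n\}$, $R=\mathbb{K}[x_1,\dots,x_n]$ with $\mathbb{K}$ a field, and $S=R[T_1,\dots,T_q]$. The facet ideal of $\Delta$ is $I=(f_1,\dots,f_q)$ with $f_i=\prod_{x\in F_i}x$. The defining ideal $J\subset S$ of $R[It]=R[f_1t,\dots,f_qt]$ is the kernel of the $R$-algebra map $S\to R[It]$, $T_i\mapsto f_it$. For $s\ge 1$ let $\mathcal{I}_s=\{(i_1,\dots,i_s): 1\le i_1\le\cdots\le i_s\le q\}$. For $\alpha=(i_1,\dots,i_s)\in\mathcal{I}_s$ put $\mathrm{Supp}(\alpha)=\{i_1,\dots,i_s\}$, $f_\alpha=f_{i_1}\cdots f_{i_s}$, $T_\alpha=T_{i_1}\cdots T_{i_s}$, and $\deg_\alpha(x)=\max\{m:x^m\mid f_\alpha\}$ for a vertex $x$. For $\alpha,\beta\in\mathcal{I}_s$, $$T_{\alpha,\beta}(I)=\frac{\mathrm{lcm}(f_\alpha,f_\beta)}{f_\alpha}T_\alpha-\frac{\mathrm{lcm}(f_\alpha,f_\beta)}{f_\beta}T_\beta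 .$$ $J_1$ is the $R$-submodule of $S$ generated by all $T_{\alpha,\beta}(I)$ with $\alpha,\beta\in\mathcal{I}_1$ and $\mathrm{Supp}(\alpha)\cap\mathrm{Supp}(\beta)=\emptyset$. For a subset $P\subset S$, $PS$ denotes the ideal of $S$ generated by $P$. For $s\ge2$, $\alpha=(i_1,\dots,i_s)$, $\beta=(j_1,\dots,j_s)\in\mathcal{I}_s$, the sequence of not necessarily distinct facets $\mathcal{C}_{\alpha,\beta}=F_{i_1},F_{j_1},\dots,F_{i_s},F_{j_s}$ is a simplicial even walk if for every $i\in\mathrm{Supp}(\alpha)$ and $j\in\mathrm{Supp}(\beta)$ we have $F_i\setminus F_j\not\subseteq\{x\in V(\Delta):\deg_\alpha(x)>\deg_\beta(x)\}$ and $F_j\setminus F_i\not\subseteq\{x\in V(\Delta):\deg_\alpha(x)<\deg_\beta(x)\}$. *)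

(* Defs.v *)
(* Over MathComp, with multinomials for polynomial rings. *)
From mathcomp Require Export all_boot all_algebra.
From mathcomp Require Export mpoly.

Set Implicit Arguments.
Unset Strict Implicit.
Unset Printing Implicit Defensive.

Import GRing.Theory.
Local Open Scope ring_scope.

Definition span_submod (R : nzRingType) (V : lmodType R) (P : V -> Prop)
    (v : V) : Prop :=
  exists s : seq (R * V),
    (forall c, c \in s -> P c.2) /\ v = \sum_(c <- s) c.1 *: c.2.

Definition span_ideal (A : comNzRingType) (P : A -> Prop) (a : A) : Prop :=
  exists s : seq (A * A),
    (forall c, c \in s -> P c.2) /\ a = \sum_(c <- s) c.1 * c.2.

Definition sum_ideal (A : comNzRingType) (I1 I2 : A -> Prop) (a : A) : Prop :=
  exists a1 a2, [/\ I1 a1, I2 a2 & a = a1 + a2].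

Definition simplicial_complex (V : finType) (Delta : {set {set V}}) : Prop :=
  forall A B : {set V}, A \in Delta -> B \subset A -> B \in Delta.

Definition vertices (V : finType) (Delta : {set {set V}}) : {set V} :=
  cover Delta.

Definition facets (V : finType) (Delta : {set {set V}}) : {set {set V}} :=
  [set A | maxset (fun B => B \in Delta) A].

Section FacetIdeal.

Variables (K : fieldType) (n q : nat) (F : 'I_q -> {set 'I_n}).

Notation R := {mpoly K[n]}.
Notation S := {mpoly {mpoly K[n]}[q]}.

Definition facet_gen (i : 'I_q) : R := \prod_(x in F i) 'X_x.

(* The codomain R[It] is a subring of R[t] = {poly R}, so the kernel of
   S -> R[It] is that of the composite S -> R[t]. *)
Definition rees_map (p : S) : {poly R} :=
  mmap (@polyC R) (fun i => (facet_gen i)%:P * 'X) p.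

Definition rees_ideal (p : S) : Prop := rees_map p = 0.

Definition multi_indices (s : nat) : {set s.-tuple 'I_q} :=
  [set a : s.-tuple 'I_q | sorted [rel i j : 'I_q | (i <= j)%N] a].

Definition Supp (s : nat) (a : s.-tuple 'I_q) : {set 'I_q} :=
  [set i | i \in a].

(* The monomial f_a, as an exponent vector: in 'X_{1..n}, multiplication is
   written + , exact division - , and divisibility <= . *)
Definition facet_mon (i : 'I_q) : 'X_{1..n} := (\sum_(x in F i) U_(x))%MM.

Definition mon (s : nat) (a : s.-tuple 'I_q) : 'X_{1..n} :=
  (\sum_(i <- a) facet_mon i)%MM.

Lemma facet_genE i : facet_gen i = 'X_[facet_mon i].
Proof. exact: mprodXE. Qed.

Lemma monE s (a : s.-tuple 'I_q) :
  'X_[mon a] = \prod_(i <- a) facet_gen i.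
Proof.
by rewrite /mon -mprodXE; apply: eq_bigr => i _; rewrite facet_genE.
Qed.

(* Every m with x^m | f_a is at most the total degree of f_a, so the range of
   the maximum loses nothing. *)
Definition vdeg (s : nat) (a : s.-tuple 'I_q) (x : 'I_n) : nat :=
  \max_(m < (mdeg (mon a)).+1 | (U_(x) *+ m <= mon a)%MM) m.

Lemma vdegE s (a : s.-tuple 'I_q) x : vdeg a x = mon a x.
Proof.
have dvdE m : (U_(x) *+ m <= mon a)%MM = (m <= mon a x)%N.
  apply/mnm_lepP/idP => [/(_ x)|le_m y]; rewrite mulmnE mnm1E.
    by rewrite eqxx mul1n.
  by case: eqP => [<-|_]; rewrite ?mul1n ?mul0n.
apply/eqP; rewrite eqn_leq; apply/andP; split.
  by apply/bigmax_leqP => m; rewrite dvdE.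
have lt_d : (mon a x < (mdeg (mon a)).+1)%N.
  by rewrite ltnS mdegE (bigD1 x) //= leq_addr.
by apply: (bigmax_sup (Ordinal lt_d)); rewrite ?dvdE.
Qed.

Definition Tmon (s : nat) (a : s.-tuple 'I_q) : S := \prod_(i <- a) 'X_i.

Definition Tbinom (s : nat) (a b : s.-tuple 'I_q) : S :=
  'X_[K, (mlcm (mon a) (mon b) - mon a)%MM] *: Tmon a
  - 'X_[K, (mlcm (mon a) (mon b) - mon b)%MM] *: Tmon b.

Definition J1 : S -> Prop :=
  span_submod (fun p : S => exists a b : 1.-tuple 'I_q,
    [/\ a \in multi_indices 1, b \in multi_indices 1,
        [disjoint Supp a & Supp b] & p = Tbinom a b]).

Definition even_walk (s : nat) (a b : s.-tuple 'I_q) : Prop :=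
  forall i j, i \in Supp a -> j \in Supp b ->
    ~~ (F i :\: F j \subset [set x | (vdeg a x > vdeg b x)%N]) /\
    ~~ (F j :\: F i \subset [set x | (vdeg a x < vdeg b x)%N]).

Definition walk_binoms (s : nat) (p : S) : Prop :=
  exists a b : s.-tuple 'I_q,
    [/\ a \in multi_indices s, b \in multi_indices s, even_walk a b
      & p = Tbinom a b].

End FacetIdeal.

Arguments rees_ideal K {n q} F p.
Arguments J1 K {n q} F p.
Arguments walk_binoms K {n q} F s p.

(* Main.v *)
(* The kernel of S -> R[t] is spanned by differences of two monomials of S with
   the same image, and each such difference is a multiple of some T_{alpha,beta}.
   If C_{alpha,beta} is not an even walk, say F_j \ F_i lies in
   {deg_alpha < deg_beta}, then lcm(f_alpha,f_beta)/f_alpha is divisible by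
   lcm(f_i,f_j)/f_i, so trading T_i for T_j in T_alpha writes T_{alpha,beta} as a
   multiple of T_{i,j} plus T_j times a multiple of T_{alpha-i,beta-j}; one
   concludes by induction on the degree. *)
Require Import Defs.

Set Implicit Arguments.
Unset Strict Implicit.
Unset Printing Implicit Defensive.

Import GRing.Theory.
Local Open Scope ring_scope.

(** * Ideals generated by a predicate, and sums grouped along fibers *)

Section Ideals.

Variables (A : comNzRingType).
Implicit Types (P Q : A -> Prop) (a b : A).

Lemma span_ideal_incl P a : P a -> span_ideal P a.
Proof.
move=> Pa; exists [:: (1, a)]; rewrite big_seq1 mul1r; split=> // c.
by rewrite inE => /eqP ->.
Qed.

Lemma span_ideal0 P : span_ideal P 0.
Proof. by exists [::]; rewrite big_nil. Qed.

Lemma span_idealD P a b :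
  span_ideal P a -> span_ideal P b -> span_ideal P (a + b).
Proof.
move=> [s [Ps ->]] [t [Pt ->]]; exists (s ++ t); rewrite big_cat; split=> // c.
by rewrite mem_cat => /orP[/Ps|/Pt].
Qed.

Lemma span_idealM P a b : span_ideal P b -> span_ideal P (a * b).
Proof.
move=> [s [Ps ->]]; exists [seq (a * c.1, c.2) | c <- s]; split.
  by move=> _ /mapP[c /Ps Pc ->].
by rewrite big_map mulr_sumr; apply: eq_bigr => c _; rewrite mulrA.
Qed.

Lemma span_ideal_sub P Q :
  Q 0 -> (forall a b, Q a -> Q b -> Q (a + b)) ->
  (forall a b, Q b -> Q (a * b)) ->
  (forall a, P a -> Q a) -> forall a, span_ideal P a -> Q a.
Proof.
move=> Q0 QD QM PQ _ [s [Ps ->]]; rewrite big_seq.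
by elim/big_rec: _ => // c b /Ps/PQ Qc Qb; apply: QD => //; apply: QM.
Qed.

Lemma sum_ideall P Q a :
  span_ideal P a -> sum_ideal (span_ideal P) (span_ideal Q) a.
Proof. by exists a, 0; rewrite addr0; split=> //; apply: span_ideal0. Qed.

Lemma sum_idealr P Q a :
  span_ideal Q a -> sum_ideal (span_ideal P) (span_ideal Q) a.
Proof. by exists 0, a; rewrite add0r; split=> //; apply: span_ideal0. Qed.

Lemma sum_idealD P Q a b :
  sum_ideal (span_ideal P) (span_ideal Q) a ->
  sum_ideal (span_ideal P) (span_ideal Q) b ->
  sum_ideal (span_ideal P) (span_ideal Q) (a + b).
Proof.
move=> [a1 [a2 [Pa Qa ->]]] [b1 [b2 [Pb Qb ->]]]; exists (a1 + b1), (a2 + b2).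
by split; [apply: span_idealD | apply: span_idealD | rewrite addrACA].
Qed.

Lemma sum_idealM P Q a b :
  sum_ideal (span_ideal P) (span_ideal Q) b ->
  sum_ideal (span_ideal P) (span_ideal Q) (a * b).
Proof.
move=> [b1 [b2 [Pb Qb ->]]]; exists (a * b1), (a * b2).
by split; [apply: span_idealM | apply: span_idealM | rewrite mulrDr].
Qed.

(** Where the coefficients over a fiber of [phi] sum to zero, one fixed [M i0] may be subtracted
    from every [M i] of that fiber at no cost, leaving a combination of differences that lie in [Q].
    This is how a kernel element is reduced to binomials. *)
Lemma ideal_sum_fibers (Q : A -> Prop) (I T : eqType) (r : seq I)
    (c M : I -> A) (phi : I -> T) :
  Q 0 -> (forall a b, Q a -> Q b -> Q (a + b)) ->
  (forall a b, Q b -> Q (a * b)) ->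
  (forall i j, phi i = phi j -> Q (M i - M j)) ->
  (forall v, \sum_(i <- r | phi i == v) c i = 0) ->
  Q (\sum_(i <- r) c i * M i).
Proof.
(* The induction is on a bound for the size, because each round removes the whole fiber of the head
   [i0] and not only the head. *)
move=> Q0 QD QM QB; have [k] := ubnP (size r); elim: k r => // k IHk [|i0 r].
  by rewrite big_nil.
rewrite ltnS /= => le_r c0; rewrite (bigID (fun i => phi i == phi i0)) /=.
apply: (QD).
  have -> : \sum_(i <- i0 :: r | phi i == phi i0) c i * M i =
      \sum_(i <- i0 :: r | phi i == phi i0) c i * (M i - M i0).
    under [RHS]eq_bigr do rewrite mulrBr.
    by rewrite sumrB -mulr_suml c0 mul0r subr0.
  by elim/big_rec: _ => // i b /eqP/QB Qi Qb; apply: QD => //; apply: QM.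
rewrite -big_filter; apply: IHk => [|v].
  rewrite /= eqxx /=; apply: leq_ltn_trans le_r.
  by rewrite size_filter count_size.
(* After the removal the fiber over [phi i0] is empty, and every other fiber is unchanged. *)
rewrite big_filter_cond; case: (eqVneq v (phi i0)) => [->|neq_v].
  by rewrite big_pred0 // => i; rewrite andNb.
rewrite -[RHS](c0 v); apply: eq_bigl => i.
by case: (eqVneq (phi i) v) => [->|]; rewrite ?andbF ?neq_v.
Qed.

End Ideals.

(** * Monomials and the binomials $T_{\alpha,\beta}$ *)

Section Binomials.

Variables (K : fieldType) (n q : nat) (F : 'I_q -> {set 'I_n}).

Notation R := {mpoly K[n]}.
Notation S := {mpoly {mpoly K[n]}[q]}.

Local Notation mon := (mon F).
Local Notation Tmon := (@Tmon K n q _).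
Local Notation Tbinom := (Tbinom K F).
Local Notation fmon := (facet_mon F).

Lemma facet_monE i x : fmon i x = (x \in F i).
Proof.
rewrite /facet_mon mnm_sumE; case: (boolP (x \in F i)) => xFi.
  rewrite (bigD1 x) //= mnm1E eqxx big1 // => y /andP[_ neq_y].
  by rewrite mnm1E (negPf neq_y).
rewrite big1 // => y yFi; rewrite mnm1E; case: eqP => // eq_y.
by rewrite -eq_y yFi in xFi.
Qed.

Lemma mon_cons s i (a : s.-tuple 'I_q) :
  mon [tuple of i :: a] = (fmon i + mon a)%MM.
Proof. by rewrite /mon big_cons. Qed.

Lemma mon_seq1 i : mon [tuple i] = fmon i.
Proof. by rewrite /mon big_seq1. Qed.

Lemma Tmon_cons s i (a : s.-tuple 'I_q) :
  Tmon [tuple of i :: a] = 'X_i * Tmon a.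
Proof. by rewrite /Tmon big_cons. Qed.

Lemma Tmon_seq1 i : Tmon [tuple i] = 'X_i.
Proof. by rewrite /Tmon big_seq1. Qed.

Lemma perm_mon s (a b : s.-tuple 'I_q) : perm_eq a b -> mon a = mon b.
Proof. exact: perm_big. Qed.

Lemma perm_Tmon s (a b : s.-tuple 'I_q) : perm_eq a b -> Tmon a = Tmon b.
Proof. exact: perm_big. Qed.

Lemma perm_Tbinom s (a a' b b' : s.-tuple 'I_q) :
  perm_eq a a' -> perm_eq b b' -> Tbinom a b = Tbinom a' b'.
Proof.
move=> pa pb; rewrite /Tbinom (perm_mon pa) (perm_mon pb).
by rewrite (perm_Tmon pa) (perm_Tmon pb).
Qed.

Lemma TbinomC s (a b : s.-tuple 'I_q) : Tbinom a b = - Tbinom b a.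
Proof. by rewrite /Tbinom mlcmC opprB. Qed.

Lemma Tbinomxx s (a : s.-tuple 'I_q) : Tbinom a a = 0.
Proof. exact: subrr. Qed.

(** The common value of the two sides is a multiple of both $f_a$ and $f_b$, hence of their lcm $L$;
    the quotient by $L$ is the cofactor [g]. *)
Lemma Tbinom_dvd s (a b : s.-tuple 'I_q) (u v : 'X_{1..n}) :
  (u + mon a = v + mon b)%MM ->
  exists g, 'X_[u] *: Tmon a - 'X_[v] *: Tmon b = g * Tbinom a b.
Proof.
move=> eq_uv; set L := mlcm (mon a) (mon b).
have le_a : (L - mon a <= u)%MM.
  apply/mnm_lepP => x; rewrite !mnmE.
  have := congr1 (fun m : 'X_{1..n} => m x) eq_uv.
  rewrite !mnmE => eq_x; rewrite leq_subLR geq_max leq_addr /=.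
  by rewrite [leqRHS]addnC eq_x leq_addl.
(* The same quotient must serve for the second term. Subtraction of exponents is truncated, so
   [le_a] is needed to compute with it. *)
have eq_v : (v = u - (L - mon a) + (L - mon b))%MM.
  apply/mnmP=> x; have := congr1 (fun m : 'X_{1..n} => m x) eq_uv.
  move/mnm_lepP: le_a => /(_ x); rewrite !mnmE.
  set A := mon a x; set B := mon b x.
  case: (leqP A B) => [leAB | /ltnW leBA] le_u eq_x.
    by rewrite subnn addn0 subnBA // eq_x addnK.
  by rewrite subnn subn0 addnBA // eq_x addnK.
exists ('X_[K, u - (L - mon a)]%:MP); rewrite /Tbinom -/L.
rewrite mul_mpolyC scalerBr !scalerA.
by rewrite -!mpolyXD submK // -eq_v.
Qed.

(** The exchange step: with $w = u f_i / f_j$, one has $u T_i T_a - v T_j T_b = T_a (u T_i - w T_j)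
    + T_j (w T_a - v T_b)$, and [Tbinom_dvd] applies to both brackets. *)
Lemma Tbinom_cons s i j (a b : s.-tuple 'I_q) :
  F j :\: F i \subset
    [set x | (vdeg F [tuple of i :: a] x < vdeg F [tuple of j :: b] x)%N] ->
  exists g h, Tbinom [tuple of i :: a] [tuple of j :: b] =
    g * Tbinom [tuple i] [tuple j] + h * Tbinom a b.
Proof.
move=> /subsetP subF; rewrite {1}/Tbinom !Tmon_cons.
set L := mlcm _ _; set u := (L - mon [tuple of i :: a])%MM; set v := (L - _)%MM.
(* That is, $f_j$ divides $u f_i$. Only a vertex of $F_j \setminus F_i$ matters; there the
   hypothesis makes the exponent in $u = L / (f_i f_a)$ positive. *)
have le_j : (fmon j <= u + fmon i)%MM.
  apply/mnm_lepP=> x; rewrite !mnmE !facet_monE.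
  case: (boolP (x \in F j)) => // xFj; case: (boolP (x \in F i)) => xFi.
    by rewrite addn1.
  have := subF x; rewrite !inE xFj xFi => /(_ isT).
  by rewrite !vdegE addn0 subn_gt0 => /leq_trans; apply; exact: leq_maxr.
set w := (u + fmon i - fmon j)%MM.
have eq_ij : (u + mon [tuple i] = w + mon [tuple j])%MM.
  by rewrite !mon_seq1 submK.
(* Multiplied by $f_j$, both sides become $L$. *)
have eq_ab : (w + mon a = v + mon b)%MM.
  apply: (@addmI _ (fmon j)); rewrite addmA [(fmon j + w)%MM]addmC submK //.
  rewrite -addmA -mon_cons submK ?lem_mlcml //.
  rewrite [(v + _)%MM]addmC addmA -mon_cons addmC submK //.
  exact: lem_mlcmr.
have [g Eg] := Tbinom_dvd eq_ij; have [h Eh] := Tbinom_dvd eq_ab.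
exists (Tmon a * g), ('X_j * h); rewrite -!mulrA -Eg -Eh !Tmon_seq1.
rewrite !mulrBr -!scalerAr addrA -addrA.
by rewrite [Tmon a * 'X_j]mulrC [Tmon a * 'X_i]mulrC addrA subrK.
Qed.

(** * Every binomial lies in the ideal of the walks *)

Definition walk_ideal (p : S) : Prop :=
  sum_ideal (span_ideal (J1 K F))
            (span_ideal (fun g => exists2 s : nat,
                           (2 <= s)%N & walk_binoms K F s g)) p.

Lemma walk_ideal0 : walk_ideal 0.
Proof. exact/sum_ideall/span_ideal0. Qed.

Lemma walk_idealD a b : walk_ideal a -> walk_ideal b -> walk_ideal (a + b).
Proof. exact: sum_idealD. Qed.

Lemma walk_idealM a b : walk_ideal b -> walk_ideal (a * b).
Proof. exact: sum_idealM. Qed.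

Lemma walk_ideal_seq1 i j : walk_ideal (Tbinom [tuple i] [tuple j]).
Proof.
case: (eqVneq i j) => [->|neq_ij].
  by rewrite Tbinomxx; apply: walk_ideal0.
apply/sum_ideall/span_ideal_incl; exists [:: (1, Tbinom [tuple i] [tuple j])].
rewrite big_seq1 scale1r; split=> // c; rewrite inE => /eqP -> /=.
exists [tuple i], [tuple j]; rewrite !inE; split=> //.
rewrite -setI_eq0; apply/eqP/setP=> k; rewrite !inE.
by apply/negP=> /andP[/eqP->]; rewrite (negPf neq_ij).
Qed.

Lemma tuple_perm_cons s i (a : s.+1.-tuple 'I_q) :
  i \in a -> exists a' : s.-tuple 'I_q, perm_eq a (i :: a').
Proof.
move=> ia; have sz : size (rem i a) == s by rewrite size_rem // size_tuple.
by exists (Tuple sz); apply: perm_to_rem.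
Qed.

(** Binomials are handled for arbitrary tuples, as [Tbinom] ignores the order of entries; sorting is
    needed only to exhibit a generator. *)
Lemma sort_multi_indices s (a : s.-tuple 'I_q) :
  exists2 b, b \in multi_indices q s & perm_eq a b.
Proof.
exists (sort_tuple [rel i j : 'I_q | (i <= j)%N] a).
  by rewrite inE /=; apply: sort_sorted => i j; apply: leq_total.
by rewrite perm_sym perm_sort.
Qed.

Lemma Tbinom_walk_ideal s (a b : s.-tuple 'I_q) : walk_ideal (Tbinom a b).
Proof.
elim: s a b => [|s IHs] a b.
  by rewrite (tuple0 a) (tuple0 b) Tbinomxx; apply: walk_ideal0.
(* Length one is split off, since walks have length at least 2 and the linear binomials come from
   [J1]. The equation keeps [IHs] stated for [s]. *)
have [[|s'] eq_s] : exists s', s' = s by exists s.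
  subst s; case/tupleP: a => i a; case/tupleP: b => j b.
  by rewrite (tuple0 a) (tuple0 b); apply: walk_ideal_seq1.
have [a1 a1P pa] := sort_multi_indices a.
have [b1 b1P pb] := sort_multi_indices b.
rewrite (perm_Tbinom pa pb) => {a b pa pb}; rename a1 into a, b1 into b.
pose lt_ab := [set x | (vdeg F a x < vdeg F b x)%N].
pose lt_ba := [set x | (vdeg F b x < vdeg F a x)%N].
(* The walk condition is put in boolean form, so that its failure yields an explicit pair [i], [j],
   which is moved to the front of [a] and [b]. *)
case: (boolP [forall i in Supp a, forall j in Supp b,
  ~~ (F i :\: F j \subset lt_ba) && ~~ (F j :\: F i \subset lt_ab)]) => [walk|].
  apply/sum_idealr/span_ideal_incl; exists s.+1; first by rewrite -eq_s.
  exists a, b; split=> // i j ia jb.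
  by move/forall_inP/(_ i ia)/forall_inP/(_ j jb)/andP: walk.
rewrite negb_forall_in => /exists_inP[i ia].
rewrite negb_forall_in => /exists_inP[j jb].
rewrite !inE in ia jb.
have [a' pa] := tuple_perm_cons ia; have [b' pb] := tuple_perm_cons jb.
have da x : vdeg F a x = vdeg F [tuple of i :: a'] x.
  by rewrite !vdegE (@perm_mon _ a [tuple of i :: a']).
have db x : vdeg F b x = vdeg F [tuple of j :: b'] x.
  by rewrite !vdegE (@perm_mon _ b [tuple of j :: b']).
rewrite (@perm_Tbinom _ a [tuple of i :: a'] b [tuple of j :: b']) //.
have in_ideal k l (c d : s.-tuple 'I_q) :
    F l :\: F k \subset
      [set x | (vdeg F [tuple of k :: c] x < vdeg F [tuple of l :: d] x)%N] ->
    walk_ideal (Tbinom [tuple of k :: c] [tuple of l :: d]).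
  case/Tbinom_cons=> g [h ->]; apply: walk_idealD; apply: walk_idealM => //.
  exact: walk_ideal_seq1.
rewrite negb_and !negbK => /orP[sub_ij|sub_ji].
  (* The two ways of failing are symmetric: exchanging [a] and [b] only changes the sign. *)
  rewrite TbinomC -mulN1r; apply/walk_idealM/in_ideal.
  apply: subset_trans sub_ij _.
  by apply/subsetP=> x; rewrite !inE da db.
apply/in_ideal; apply: subset_trans sub_ji _.
by apply/subsetP=> x; rewrite !inE da db.
Qed.

(** * The binomials lie in the kernel of the Rees map *)

Local Notation rees_map := (@rees_map K n q F).

Lemma rees_map_term s (a : s.-tuple 'I_q) (u : 'X_{1..n}) :
  rees_map ('X_[u] *: Tmon a) = 'X_[u + mon a]%:P * 'X^s.
Proof.
rewrite /rees_map mmapZ /Tmon rmorph_prod /=.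
under eq_bigr => i _ do rewrite mmapX mmap1U.
rewrite big_split /= big_const_seq count_predT size_tuple iter_mulr_1.
by rewrite mpolyXD monE rmorphM rmorph_prod /= mulrA.
Qed.

(** Both terms are sent to $\mathrm{lcm}(f_a,f_b)\, t^s$. *)
Lemma rees_map_Tbinom s (a b : s.-tuple 'I_q) : rees_map (Tbinom a b) = 0.
Proof.
rewrite /Tbinom {1}/Defs.rees_map raddfB /= -!/(rees_map _) !rees_map_term.
by rewrite !submK ?lem_mlcml ?lem_mlcmr // subrr.
Qed.

Lemma rees_map0 : rees_map 0 = 0.
Proof. exact: raddf0. Qed.

Lemma rees_mapD p p' : rees_map (p + p') = rees_map p + rees_map p'.
Proof. exact: raddfD. Qed.

Lemma rees_mapM p p' : rees_map (p * p') = rees_map p * rees_map p'.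
Proof. exact: rmorphM. Qed.

Lemma span_ideal_rees (P : S -> Prop) p :
  (forall g, P g -> rees_map g = 0) -> span_ideal P p -> rees_map p = 0.
Proof.
move=> PJ; move: p.
apply: (@span_ideal_sub _ P (fun g => rees_map g = 0) _ _ _ PJ)
  => [|g h Jg Jh|g h Jh].
- exact: rees_map0.
- by rewrite rees_mapD Jg Jh addr0.
- by rewrite rees_mapM Jh mulr0.
Qed.

Lemma J1_rees p : J1 K F p -> rees_map p = 0.
Proof.
move=> [r [J1r ->]].
apply: (@span_ideal_rees
  (fun g => exists a b : 1.-tuple 'I_q, g = Tbinom a b)).
  by move=> g [a [b ->]]; apply: rees_map_Tbinom.
(* [J1] is only an $R$-submodule; its scalars become constants of $S$, so that the ideal version
   applies. *)
exists [seq (c.1%:MP, c.2) | c <- r]; split.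
  by move=> _ /mapP[c /J1r[a [b [_ _ _ eq_c]]] ->]; exists a, b.
by rewrite big_map; apply: eq_bigr => c _; rewrite mul_mpolyC.
Qed.

Lemma rees_walk_ideal p : walk_ideal p -> rees_map p = 0.
Proof.
case=> p1 [p2 [I1 I2 ->]]; rewrite rees_mapD (span_ideal_rees J1_rees I1) add0r.
apply: span_ideal_rees I2 => _ [s _ [a [b [_ _ _ ->]]]].
exact: rees_map_Tbinom.
Qed.

(** * The kernel is generated by binomials *)

Definition mnm_tuple (m : 'X_{1..q}) : (mdeg m).-tuple 'I_q :=
  tcast (size_m2s m) (in_tuple (m2s m)).

Lemma Tmon_mnm_tuple m : Tmon (mnm_tuple m) = 'X_[m].
Proof.
rewrite /Tmon /mnm_tuple val_tcast /= -[in RHS](s2mK m) /s2m.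
rewrite mprodXE; congr mpolyX; apply/mnmP=> i.
rewrite mnmE mnm_sumE -sum1_count [RHS]big_mkcond.
by apply: eq_bigr => j _; rewrite mnm1E /=; case: eqP.
Qed.

(** Expanding in the $T_i$, and then each coefficient in the $x_j$, leaves scalars in $K$ times
    monomials of $S$, the shape required by [ideal_sum_fibers]. *)
Lemma mpoly_nestedE (p : S) :
  p = \sum_(x <- [seq (m, u) | m <- msupp p, u <- msupp p@_m])
        (p@_(x.1)@_(x.2))%:MP%:MP * ('X_[x.2] *: Tmon (mnm_tuple x.1)).
Proof.
rewrite big_allpairs_dep /= {1}(mpolyE p); apply: eq_bigr => m _.
rewrite {1}(mpolyE p@_m) scaler_suml; apply: eq_bigr => u _.
by rewrite Tmon_mnm_tuple mul_mpolyC scalerA mul_mpolyC.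
Qed.

Lemma walk_ideal_rees p : rees_map p = 0 -> walk_ideal p.
Proof.
move=> Jp; rewrite (mpoly_nestedE p).
(* [phi] records the image $x^w t^d$ of a monomial of $S$ as the pair of exponents $(w,d)$. Equal
   values give tuples of the same length, to which [Tbinom_dvd] applies. *)
pose phi (x : 'X_{1..q} * 'X_{1..n}) :=
  (x.2 + mon (mnm_tuple x.1), mdeg x.1)%MM.
apply: (@ideal_sum_fibers _ walk_ideal _ _ _ _ _ phi).
- exact: walk_ideal0.
- exact: walk_idealD.
- exact: walk_idealM.
- move=> [m u] [m' u'] /eqP; rewrite xpair_eqE /=.
  move=> /andP[/eqP eq_mon /eqP eq_deg].
  move: (mnm_tuple m) (mnm_tuple m') eq_mon; rewrite eq_deg => a b eq_mon.
  have [g ->] := Tbinom_dvd eq_mon.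
  exact/walk_idealM/Tbinom_walk_ideal.
(* The sum over the fiber of $(w,d)$ is the coefficient of $x^w t^d$ in [rees_map p], which vanishes
   by [Jp]. *)
move=> [w d]; rewrite -!rmorph_sum /= (_ : \sum_(x <- _ | _) _ = 0) ?rmorph0 //.
have := congr1 (fun f : {poly R} => f`_d@_w) Jp.
rewrite {1}(mpoly_nestedE p) /Defs.rees_map raddf_sum /= coef_sum raddf_sum /=.
rewrite coef0 mcoeff0; apply: etrans; rewrite big_mkcond /=.
apply: eq_bigr => x _.
rewrite rmorphM /= mmapC -/(rees_map _) rees_map_term.
rewrite coefCM coefCM coefXn mcoeffCM eq_sym /phi xpair_eqE mulr_natr.
case: (eqVneq d (mdeg x.1)) => _; rewrite ?andbF ?andbT ?mcoeff0 ?mulr0 //.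
by rewrite mcoeffX eq_sym; case: eqP; rewrite ?mulr1 ?mulr0.
Qed.

End Binomials.

Theorem corollary4p3 (K : fieldType) (n q : nat)
    (Delta : {set {set 'I_n}}) (F : 'I_q -> {set 'I_n})
    (hDelta : simplicial_complex Delta)
    (hV : vertices Delta = [set: 'I_n])
    (F_inj : injective F)
    (hF : [set F i | i : 'I_q] = facets Delta) :
  forall p : {mpoly {mpoly K[n]}[q]},
    rees_ideal K F p <->
    sum_ideal (span_ideal (J1 K F))
              (span_ideal (fun g => exists2 s : nat,
                             (2 <= s)%N & walk_binoms K F s g)) p.
Proof.
by move=> p; split; [exact: walk_ideal_rees | exact: rees_walk_ideal].
Qed.
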